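(* Fix the number of objectives $p\ge1$ and allow the problem size $(n,m)$ to vary. Then there are multiobjective linear programs with $p$ objectives for which the number of non-efficient vertices of $Y^\square$ grows at least as fast as $\Omega(n^{\lfloor (p-1)/2\rfloor})$. That is, for each fixed $p$ there exist a constant $c>0$ and an integer $n_0$ such that for every $n\ge n_0$ there is a multiobjective linear program with $p$ objectives and $n$ variables (and some number $m$ of equality constraints) for which $Y^\square$ has at least $c\,n^{\lfloor (p-1)/2\rfloor}$ non-efficient vertices.
   Context: $\mathbb{E}_d$ denotes $d$-dimensional Euclidean space; the vector relations $\le$ and $<$ are componentwise (with $<$ meaning strict in every component); a polytope is a bounded intersection of finitely many closed half-spaces. Multiobjective linear program with $p$ objectives, $n$ variables and $m$ equality constraints (problem size $(n,m)$): given an $m\times n$ real matrix $A$, $\mathbf b\in\mathbb{R}^m$ and a $p\times n$ real objective matrix $C$, the feasible set $X=\{\mathbf x\in\mathbb{E}_n : A\mathbf x=\mathbf b,\ \mathbf x\ge\mathbf 0\}$ is assumed to be bounded, and the outcome set is the polytope $Y^==\{C\mathbf x:\mathbf x\in X\}\subseteq\mathbb{E}_p$. The polytope $Y^\square$: choose a point $\widehat{\mathbf y}\in\mathbb{E}_p$ with $\widehat{\mathbf y}<\mathbf y$ for all $\mathbf y\in Y^=$, and set $Y^\square=\{\mathbf z\in\mathbb{E}_p : \widehat{\mathbf y}\le\mathbf z\le\mathbf y\text{ for some }\mathbf y\in Y^=\}$. A point $\mathbf z\in Y^\square$ is efficient if there is no other $\mathbf z'\in Y^\square$, $\mathbf z'\ne\mathbf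 z$, with $\mathbf z'\ge\mathbf z$; a non-efficient vertex of $Y^\square$ is a vertex that is not efficient. *)

(* Defs.v *)
From mathcomp Require Import all_boot all_order all_algebra.
From mathcomp Require Import all_classical all_reals all_analysis.

Set Implicit Arguments.
Unset Strict Implicit.
Unset Printing Implicit Defensive.

Import Order.TTheory GRing.Theory Num.Theory numFieldNormedType.Exports.

Local Open Scope classical_set_scope.
Local Open Scope ring_scope.

(* [vlt] is strict in every component; it is not the strict part of [vle]. *)
Definition vle (R : realType) (d : nat) (u v : 'cV[R]_d) : Prop :=
  forall i : 'I_d, u i 0 <= v i 0.

Definition vlt (R : realType) (d : nat) (u v : 'cV[R]_d) : Prop :=
  forall i : 'I_d, u i 0 < v i 0.

Definition feasible (R : realType) (n m : nat)
    (A : 'M[R]_(m, n)) (b : 'cV[R]_m) : set 'cV[R]_n :=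
  [set x | A *m x = b /\ vle 0 x].

Record molp (R : realType) (p n m : nat) := Molp {
  molp_A : 'M[R]_(m, n);
  molp_b : 'cV[R]_m;
  molp_C : 'M[R]_(p, n);
  molp_bounded : bounded_set (feasible molp_A molp_b)
}.

Definition outcome (R : realType) (p n m : nat) (L : molp R p n m)
    : set 'cV[R]_p :=
  [set molp_C L *m x | x in feasible (molp_A L) (molp_b L)].

Definition strictly_below (R : realType) (p : nat)
    (yhat : 'cV[R]_p) (Y : set 'cV[R]_p) : Prop :=
  forall y, Y y -> vlt yhat y.

Definition ysquare (R : realType) (p : nat)
    (yhat : 'cV[R]_p) (Y : set 'cV[R]_p) : set 'cV[R]_p :=
  [set z | vle yhat z /\ exists2 y, Y y & vle z y].

Definition efficient (R : realType) (p : nat)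
    (P : set 'cV[R]_p) (z : 'cV[R]_p) : Prop :=
  P z /\ ~ (exists z', [/\ P z', z' <> z & vle z z']).

(* The inequality <a, y> <= a0 is valid on P and F is its equality set; a = 0
   is allowed, so that P itself (take a0 = 0) is a face of P. *)
Definition face (R : realType) (d : nat) (P F : set 'cV[R]_d) : Prop :=
  exists (a : 'rV[R]_d) (a0 : R),
    (forall y, P y -> (a *m y) 0 0 <= a0) /\
    F = P `&` [set y | (a *m y) 0 0 = a0].

Definition vertex (R : realType) (d : nat) (P : set 'cV[R]_d) (v : 'cV[R]_d)
    : Prop :=
  face P [set v].

Definition nonefficient_vertices (R : realType) (p : nat) (P : set 'cV[R]_p)
    : set 'cV[R]_p :=
  [set v | vertex P v /\ ~ efficient P v].

(* Quantifying over all points strictly below the outcome set is never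
   vacuous. *)
Lemma strictly_below_exists (R : realType) (p n m : nat) (L : molp R p n m) :
  exists yhat : 'cV[R]_p, strictly_below yhat (outcome L).
Proof.
have [M [_ hM]] := molp_bounded L.
pose K := `|M| + 1.
have hK x : feasible (molp_A L) (molp_b L) x -> `|x| <= K.
  by apply: hM; rewrite /K (le_lt_trans (ler_norm M)) // ltrDl ltr01.
exists (\col_i (- (\sum_j `|molp_C L i j| * K) - 1)) => _ [x hx <-] i.
rewrite !mxE ltrBlDr (@le_lt_trans _ _ (\sum_j molp_C L i j * x j 0)) //; last first.
  by rewrite ltrDl ltr01.
rewrite lerNl -sumrN ler_sum // => j _.
apply: le_trans (ler_norm _) _; rewrite normrN normrM ler_wpM2l //.
apply: le_trans (hK x hx).
rewrite [leRHS]mx_normrE.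
exact: (le_bigmax _ (fun ij : 'I_n * 'I_1 => `|x ij.1 ij.2|) (j, 0)).
Qed.

(* Main.v *)
(** The outcome set is a product of [k = (p - 1) %/ 2] planar polygons, each
    with its vertices [(t, - t^2)], [t = 1, 2, ...], on a parabola, times the
    origin in the other [p - 2k >= 1] coordinates.  Its preimage [X] is a product
    of simplices, so it needs one variable per polygon vertex and the number of
    vertices of the product is of order [n ^ k].  At [(s, - s^2)] the strictly
    positive functional [(2s, 1)] has its unique maximum over the polygon, since
    [2 s t - t^2 = s^2 - (t - s)^2].  Completing a vertex of the product by [yhat]
    in the remaining coordinates gives a vertex of [Y^square]; it is dominated by
    the vertex of the product itself, hence it is not efficient. *)
Require Import Defs.
From mathcomp Require Import all_boot all_order all_algebra.
From mathcomp Require Import all_classical all_reals all_analysis.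
From mathcomp Require Import ring zify.

Set Implicit Arguments.
Unset Strict Implicit.
Unset Printing Implicit Defensive.

Import Order.TTheory GRing.Theory Num.Theory numFieldNormedType.Exports.

Local Open Scope classical_set_scope.
Local Open Scope card_scope.
Local Open Scope ring_scope.

(** * Simplices, parabola polygons and their supporting functionals *)

(* Variable [j] is vertex number [j %/ K] of the simplex number [j %% K]. *)
Definition simplices_mx (R : realType) (K n : nat) : 'M[R]_(K, n) :=
  \matrix_(i, j) (j %% K == i)%N%:R.

Definition simplices (R : realType) (K n : nat) : set 'cV[R]_n :=
  feasible (simplices_mx R K n) (const_mx 1).
Arguments simplices : clear implicits.

(* Coordinate [o] (first: [false], second: [true]) of the point with abscissa
   [t + 1] on the parabola. *)
Definition parabola (R : realType) (o : bool) (t : nat) : R :=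
  if o then - t.+1%:R ^+ 2 else t.+1%:R.

Definition parabola_normal (R : realType) (o : bool) (s : nat) : R :=
  if o then 1 else 2 * s.+1%:R.

(* There is one more simplex than polygons; the objectives ignore it.  It makes
   the simplices cover all the variables also when [k = 0]. *)
Definition polygons_mx (R : realType) (k p n : nat) : 'M[R]_(p, n) :=
  \matrix_(l, j) if (l < k.*2)%N && (j %% k.+1 == l./2)%N
                 then parabola R (odd l) (j %/ k.+1)%N else 0.

(** The entry -1 makes the lower bound [yhat] optimal in the coordinates outside the polygons. *)
Definition support_row (R : realType) (k p : nat) (F : nat -> nat) : 'rV[R]_p :=
  \row_l if (l < k.*2)%N then parabola_normal R (odd l) (F l./2) else -1.

Definition lifted_vertex (R : realType) (k p : nat) (yhat : 'cV[R]_p)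
    (F : nat -> nat) : 'cV[R]_p :=
  \col_l if (l < k.*2)%N then parabola R (odd l) (F l./2) else yhat l 0.

Definition simplices_vertex (R : realType) (K n : nat) (F : nat -> nat)
    : 'cV[R]_n :=
  \col_j (j %/ K == F (j %% K))%N%:R.

Lemma parabola_normal_gt0 (R : realType) (o : bool) (s : nat) :
  0 < parabola_normal R o s.
Proof. by case: o => /=; rewrite ?mulr_gt0 ?ltr0n. Qed.

Lemma parabola_inj (R : realType) (s t : nat) :
  parabola R false s = parabola R false t -> s = t.
Proof. by move=> /eqP; rewrite /parabola eqr_nat => /eqP []. Qed.

(** * The product of simplices: block sums, boundedness, vertices *)

Lemma simplices_sum (R : realType) (K n : nat) (x : 'cV[R]_n) (i : nat) :
  simplices R K n x -> (i < K)%N -> \sum_(j < n | (j %% K == i)%N) x j 0 = 1.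
Proof.
move=> [hA _] iK; have /matrixP/(_ (Ordinal iK) 0) := hA.
rewrite !mxE => <-; rewrite big_mkcond; apply: eq_bigr => j _.
by rewrite !mxE /=; case: ifP; rewrite ?mul1r ?mul0r.
Qed.

(** The weights in each block sum to 1. This turns a constant into a linear form in [x], to be
    compared termwise with the objective. *)
Lemma simplices_sum_blocks (R : realType) (K n : nat) (x : 'cV[R]_n)
    (H : nat -> R) :
  simplices R K.+1 n x -> \sum_(j < n) H (j %% K.+1)%N * x j 0 = \sum_(i < K.+1) H i.
Proof.
move=> hx; pose blk (j : 'I_n) : 'I_K.+1 := inord (j %% K.+1)%N.
have blkE j : blk j = (j %% K.+1)%N :> nat by rewrite inordK ?ltn_pmod.
rewrite (partition_big blk xpredT) //=; apply: eq_bigr => i _.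
rewrite -[RHS]mulr1 -(simplices_sum hx (ltn_ord i)) mulr_sumr.
apply: eq_big => [j|j /eqP <-]; last by rewrite blkE.
by rewrite -blkE -val_eqE.
Qed.

Lemma simplices_le1 (R : realType) (K n : nat) (x : 'cV[R]_n) (j : 'I_n) :
  simplices R K.+1 n x -> x j 0 <= 1.
Proof.
move=> hx; have x0 j' : 0 <= x j' 0 by have := hx.2 j'; rewrite mxE.
rewrite -(simplices_sum hx (ltn_pmod j (ltn0Sn K))) (bigD1 j) //=.
by rewrite lerDl sumr_ge0.
Qed.

Lemma simplices_bounded (R : realType) (K n : nat) :
  bounded_set (simplices R K.+1 n).
Proof.
exists 1; split; first exact: num_real.
move=> M M1 x hx; apply: le_trans (ltW M1).
rewrite [leLHS]mx_normrE; apply: bigmax_le => //= -[j i] _ /=.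
rewrite (ord1 i) ger0_norm; first exact: simplices_le1 hx.
by have := hx.2 j; rewrite mxE.
Qed.

Lemma simplices_vertexP (R : realType) (K n : nat) (F : nat -> nat) :
  (forall i, (F i < n %/ K.+1)%N) ->
  simplices R K.+1 n (simplices_vertex R K.+1 n F).
Proof.
move=> hF; split; last by move=> j; rewrite !mxE ler0n.
apply/colP => i; rewrite !mxE.
(* This is the index of the only variable of block [i] with value 1. *)
have jn : (F i * K.+1 + i < n)%N.
  have := hF i; have := ltn_ord i; have := leq_divM n K.+1; nia.
rewrite (bigD1 (Ordinal jn)) //= !mxE /= modnMDl divnMDl //.
rewrite modn_small ?divn_small ?ltn_ord // addn0 !eqxx mulr1 big1 ?addr0 //.
move=> j /eqP jne; rewrite !mxE.
case: eqP => [ji|_]; last by rewrite mul0r.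
case: eqP => [jF|_]; last by rewrite mulr0.
case: jne; apply: val_inj => /=.
by rewrite {1}(divn_eq j K.+1) jF ji.
Qed.

(** * The supporting functional on the product of polygons *)

Lemma support_polygonsE (R : realType) (k p n : nat) (F : nat -> nat)
    (j : 'I_n) (i := (j %% k.+1)%N) :
  (k.*2 < p)%N ->
  (support_row R k p F *m polygons_mx R k p n) 0 j =
  if (i < k)%N
  then (F i).+1%:R ^+ 2 - ((j %/ k.+1)%N.+1%:R - (F i).+1%:R) ^+ 2 else 0.
Proof.
move=> kp; rewrite mxE; case: ifP => ik; last first.
  rewrite big1 // => l _; rewrite [polygons_mx _ _ _ _ _ _]mxE.
  case: ifP; rewrite ?mulr0 //.
  by case/andP=> lk /eqP il; exfalso; move: ik; rewrite /i il; lia.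
(* Column [j] is supported on the two coordinates of polygon [i]. *)
have p0 : (i.*2 < p)%N by lia.
have p1 : (i.*2.+1 < p)%N by lia.
rewrite (bigD1 (Ordinal p0)) //= (bigD1 (Ordinal p1)) /=; last first.
  by rewrite -val_eqE /=; lia.
rewrite big1 => [|l /andP[/eqP l0 /eqP l1]]; last first.
  rewrite [polygons_mx _ _ _ _ _ _]mxE; case: ifP; rewrite ?mulr0 //.
  move=> /andP[lk /eqP il].
  have := odd_double_half l; rewrite -il; case: (odd l) => /= le.
    by case: l1; apply: val_inj.
  by case: l0; apply: val_inj.
rewrite !mxE /= odd_double doubleK uphalf_double /= eqxx.
have -> : (i.*2 < k.*2)%N by lia.
have -> : (i.*2.+1 < k.*2)%N by lia.
by rewrite /parabola /parabola_normal /=; ring.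
Qed.

(* The defect is a sum of squares of distances along the parabola, weighted by
   the barycentric coordinates. *)
Lemma support_outcomeE (R : realType) (k p n : nat) (F : nat -> nat)
    (x : 'cV[R]_n) :
  (k.*2 < p)%N -> simplices R k.+1 n x ->
  (support_row R k p F *m (polygons_mx R k p n *m x)) 0 0 =
  \sum_(i < k.+1) (if (i < k)%N then (F i).+1%:R ^+ 2 else 0) -
  \sum_(j < n | (j %% k.+1 < k)%N)
     ((j %/ k.+1)%N.+1%:R - (F (j %% k.+1)%N).+1%:R) ^+ 2 * x j 0.
Proof.
move=> kp hx.
rewrite mulmxA mxE.
rewrite -(@simplices_sum_blocks R k n x
  (fun i => if (i < k)%N then (F i).+1%:R ^+ 2 else 0) hx).
rewrite [X in _ - X]big_mkcond -sumrB; apply: eq_bigr => j _.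
rewrite support_polygonsE //; case: ifP => _; last by rewrite mul0r subr0.
by rewrite mulrBl.
Qed.

(** In the first [k] blocks all weight sits on the vertices chosen by [F]; the last block is free,
    since the objectives ignore it. *)
Lemma polygons_rowE (R : realType) (k p n : nat) (F : nat -> nat)
    (x : 'cV[R]_n) (l : 'I_p) :
  simplices R k.+1 n x ->
  (forall j : 'I_n, (j %% k.+1 < k)%N ->
     (j %/ k.+1)%N <> F (j %% k.+1)%N -> x j 0 = 0) ->
  (polygons_mx R k p n *m x) l 0 =
  if (l < k.*2)%N then parabola R (odd l) (F l./2) else 0.
Proof.
move=> hx x0; rewrite mxE; case: ifP => lk; last first.
  by rewrite big1 // => j _; rewrite mxE lk mul0r.
have lk' : (l./2 < k.+1)%N by lia.
rewrite -[RHS]mulr1 -(simplices_sum hx lk') mulr_sumr [RHS]big_mkcond.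
apply: eq_bigr => j _; rewrite mxE lk /=; case: ifP => [/eqP jl|]; last first.
  by rewrite mul0r.
have [jF|/eqP jF] := eqVneq (j %/ k.+1)%N (F l./2); first by rewrite jF.
by rewrite x0 ?mulr0 ?jl //; lia.
Qed.

Lemma polygons_vertexE (R : realType) (k p n : nat) (F : nat -> nat)
    (l : 'I_p) :
  (forall i, (F i < n %/ k.+1)%N) ->
  (polygons_mx R k p n *m simplices_vertex R k.+1 n F) l 0 =
  if (l < k.*2)%N then parabola R (odd l) (F l./2) else 0.
Proof.
move=> hF; apply: polygons_rowE; first exact: simplices_vertexP.
by move=> j _ /eqP/negbTE jF; rewrite mxE jF.
Qed.

(** * The program, and the lifted vertices as non-efficient vertices *)

Definition polygons_molp (R : realType) (k p n : nat) : molp R p n k.+1 :=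
  Molp (polygons_mx R k p n) (simplices_bounded R k n).

Lemma polygons_vertex_outcome (R : realType) (k p n : nat) (F : nat -> nat) :
  (forall i, (F i < n %/ k.+1)%N) ->
  outcome (polygons_molp R k p n)
    (polygons_mx R k p n *m simplices_vertex R k.+1 n F).
Proof. by move=> hF; eexists; [exact: simplices_vertexP hF |]. Qed.

Lemma lifted_vertex_ysquare (R : realType) (k p n : nat) (yhat : 'cV[R]_p)
    (F : nat -> nat) :
  (forall i, (F i < n %/ k.+1)%N) ->
  strictly_below yhat (outcome (polygons_molp R k p n)) ->
  ysquare yhat (outcome (polygons_molp R k p n)) (lifted_vertex k yhat F).
Proof.
move=> hF below; set y := polygons_mx R k p n *m simplices_vertex R k.+1 n F.
have Yy : outcome (polygons_molp R k p n) y by exact: polygons_vertex_outcome.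
have yy := below _ Yy; split=> [l|]; last exists y => // l; move: (yy l);
  by rewrite [lifted_vertex _ _ _ _ _]mxE polygons_vertexE //;
    case: ifP => // _ /ltW.
Qed.

Lemma lifted_vertex_vertex (R : realType) (k p n : nat) (yhat : 'cV[R]_p)
    (F : nat -> nat) :
  (k.*2 < p)%N -> (forall i, (F i < n %/ k.+1)%N) ->
  strictly_below yhat (outcome (polygons_molp R k p n)) ->
  vertex (ysquare yhat (outcome (polygons_molp R k p n)))
    (lifted_vertex k yhat F).
Proof.
move=> kp hF below; set v := lifted_vertex k yhat F.
set a := support_row R k p F.
have vP := lifted_vertex_ysquare hF below.
suff key z : ysquare yhat (outcome (polygons_molp R k p n)) z ->
    (a *m z) 0 0 <= (a *m v) 0 0 /\ ((a *m z) 0 0 = (a *m v) 0 0 -> z = v).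
  exists a, ((a *m v) 0 0); split=> [z /key[] //|].
  apply/seteqP; split=> [z -> //|z [/key[_ h] /h //]].
move=> [zge [_ [x hx <-] /= zle]].
set y := polygons_mx R k p n *m x in zle.
set y0 := polygons_mx R k p n *m simplices_vertex R k.+1 n F.
have x_ge0 j : 0 <= x j 0 by have := hx.2 j; rewrite mxE.
pose defect := \sum_(j < n | (j %% k.+1 < k)%N)
  ((j %/ k.+1)%N.+1%:R - (F (j %% k.+1)%N).+1%:R) ^+ 2 * x j 0.
have defect_term_ge0 (j : 'I_n) : (j %% k.+1 < k)%N ->
    0 <= ((j %/ k.+1)%N.+1%:R - (F (j %% k.+1)%N).+1%:R) ^+ 2 * x j 0.
  by move=> _; rewrite mulr_ge0 ?sqr_ge0.
have defect_ge0 : 0 <= defect by apply: sumr_ge0.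
have ay : (a *m y0) 0 0 - (a *m y) 0 0 = defect.
  rewrite !support_outcomeE //; last exact: simplices_vertexP.
  (* The defect of [y0] is zero: off the chosen vertices the weight vanishes, on them the distance
     does. *)
  rewrite [X in _ - X - _]big1 => [|j _]; first by rewrite /defect; ring.
  by rewrite mxE; case: eqP => [->|]; rewrite ?subrr ?expr0n ?mul0r ?mulr0.
pose gap (l : 'I_p) := if (l < k.*2)%N
  then parabola_normal R (odd l) (F l./2) * (y l 0 - z l 0)
  else z l 0 - yhat l 0.
have gap_ge0 l : 0 <= gap l.
  rewrite /gap; case: ifP => _; last by rewrite subr_ge0 zge.
  by rewrite mulr_ge0 ?subr_ge0 ?zle // ltW // parabola_normal_gt0.
(* In the polygon coordinates [v] agrees with [y0], so [v - z] splits as [(y - z) + (y0 - y)]; in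
   the others [y] and [y0] are both 0. *)
have diff : (a *m v) 0 0 - (a *m z) 0 0 = \sum_l gap l + defect.
  rewrite -ay 4!mxE -!sumrB -big_split; apply: eq_bigr => l _ /=.
  rewrite polygons_vertexE // /gap ![support_row _ _ _ _ _ _]mxE.
  rewrite [lifted_vertex _ _ _ _ _]mxE -/y.
  case: ifP => lk; first by ring.
  suff -> : y l 0 = 0 by ring.
  by rewrite /y mxE big1 // => j _; rewrite mxE lk mul0r.
have gaps_ge0 : 0 <= \sum_l gap l by apply: sumr_ge0.
split; first by rewrite -subr_ge0 diff addr_ge0.
move=> /eqP; rewrite eq_sym -subr_eq0 diff paddr_eq0 // => /andP[/eqP g0 /eqP d0].
have gap0 l : gap l = 0 by apply: (psumr_eq0P _ g0).
(* Equality forces zero weight wherever the distance is nonzero, so [y] agrees with [v] in the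
   polygon coordinates; the zero gaps then give [z = v]. *)
have x0 (j : 'I_n) : (j %% k.+1 < k)%N ->
     (j %/ k.+1)%N <> F (j %% k.+1)%N -> x j 0 = 0.
  move=> jk jF; have /eqP := psumr_eq0P defect_term_ge0 d0 jk.
  rewrite mulf_eq0 sqrf_eq0 subr_eq0 eqr_nat eqSS => /orP[] /eqP // /jF.
apply/colP => l; rewrite mxE; have := gap0 l; rewrite /gap.
case: ifP => lk; last by move/eqP; rewrite subr_eq0 => /eqP.
move/eqP; rewrite mulf_eq0 gt_eqF ?parabola_normal_gt0 //= subr_eq0 => /eqP <-.
by rewrite /y (polygons_rowE _ hx x0) lk.
Qed.

Lemma lifted_vertex_nonefficient (R : realType) (k p n : nat)
    (yhat : 'cV[R]_p) (F : nat -> nat) :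
  (k.*2 < p)%N -> (forall i, (F i < n %/ k.+1)%N) ->
  strictly_below yhat (outcome (polygons_molp R k p n)) ->
  ~ efficient (ysquare yhat (outcome (polygons_molp R k p n)))
    (lifted_vertex k yhat F).
Proof.
move=> kp hF below [_]; apply.
set y := polygons_mx R k p n *m simplices_vertex R k.+1 n F.
have Yy : outcome (polygons_molp R k p n) y by exact: polygons_vertex_outcome.
have yy := below _ Yy; exists y; split.
- by split=> [l|]; [exact: ltW (yy l) | exists y].
(* Coordinate [k.*2] is the first outside the polygons; there [y] lies strictly above [yhat]. *)
- move=> /colP/(_ (Ordinal kp)); have := yy (Ordinal kp).
  by rewrite [RHS]mxE /= ltnn => /lt_eqF/eqP h /esym.
- move=> l; move: (yy l).
  by rewrite [lifted_vertex _ _ _ _ _]mxE polygons_vertexE //;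
    case: ifP => // _ /ltW.
Qed.

(** * Counting the lifted vertices *)

Lemma nonefficient_vertices_card (R : realType) (k p n : nat)
    (yhat : 'cV[R]_p) :
  (k.*2 < p)%N -> (k < n)%N ->
  strictly_below yhat (outcome (polygons_molp R k p n)) ->
  `I_((n %/ k.+1) ^ k) #<=
    nonefficient_vertices (ysquare yhat (outcome (polygons_molp R k p n))).
Proof.
move=> kp kn below; set r := (n %/ k.+1)%N.
have r0 : (0 < r)%N by rewrite divn_gt0.
(* The default 0 selects vertex 0 in the extra simplex, a legal choice since [r] is positive. *)
pose ext (f : {ffun 'I_k -> 'I_r}) (i : nat) : nat :=
  oapp (fun i' : 'I_k => val (f i')) 0%N (insub i).
have ext_lt f i : (ext f i < r)%N.
  by rewrite /ext; case: insub => [i'|] //=; apply: ltn_ord.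
have ext_inj f g : lifted_vertex k yhat (ext f) = lifted_vertex k yhat (ext g) ->
    f = g.
  move=> fg; apply/ffunP => i; apply: val_inj.
  have ip : (i.*2 < p)%N by have := ltn_ord i; lia.
  have := congr1 (fun w : 'cV[R]_p => w (Ordinal ip) 0) fg.
  rewrite !mxE /= ltn_double ltn_ord odd_double doubleK => /parabola_inj.
  by rewrite /ext valK.
have -> : (r ^ k)%N = #|{ffun 'I_k -> 'I_r}| by rewrite card_ffun !card_ord.
rewrite (card_le_eql card_II).
suff /injfunPex[f] : exists2 f : 'I_#|{ffun 'I_k -> 'I_r}| -> 'cV[R]_p,
    set_fun [set: _] (nonefficient_vertices
      (ysquare yhat (outcome (polygons_molp R k p n)))) f & set_inj [set: _] f.
  exact: inj_card_le.
exists (fun i => lifted_vertex k yhat (ext (enum_val i))).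
  by move=> i _; split; [exact: lifted_vertex_vertex
    | exact: lifted_vertex_nonefficient].
by move=> i j _ _ /ext_inj /enum_val_inj.
Qed.

(** With [q = n %/ K >= 1], [n < (q + 1) * K <= 2 * q * K]; the factor 2 absorbs the rounding. *)
Lemma divn_lower_bound (R : realType) (K n : nat) :
  (0 < K)%N -> (K <= n)%N -> (2 * K)%:R^-1 * n%:R <= (n %/ K)%:R :> R.
Proof.
move=> K0 Kn; rewrite ler_pdivrMl ?ltr0n ?muln_gt0 // -natrM ler_nat.
have := ltn_ceil n K0; have : (0 < n %/ K)%N by rewrite divn_gt0.
nia.
Qed.

Theorem corollary4p12 (R : realType) (p : nat) (hp : (1 <= p)%N) :
  exists (c : R) (n0 : nat), 0 < c /\
    forall n : nat, (n0 <= n)%N ->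
      exists (m : nat) (L : molp R p n m),
        forall yhat : 'cV[R]_p, strictly_below yhat (outcome L) ->
          exists N : nat,
            c * n%:R ^+ ((p - 1) %/ 2)%N <= N%:R /\
            `I_N #<= nonefficient_vertices (ysquare yhat (outcome L)).
Proof.
set k := ((p - 1) %/ 2)%N; have kp : (k.*2 < p)%N by rewrite /k; lia.
(* From [n = k.+1] on, each of the [k.+1] simplices has at least one vertex. *)
exists ((2 * k.+1)%:R^-1 ^+ k), k.+1; split.
  by rewrite exprn_gt0 // invr_gt0 ltr0n.
move=> n kn; exists k.+1, (polygons_molp R k p n) => yhat below.
exists ((n %/ k.+1) ^ k)%N; split; last exact: nonefficient_vertices_card.
rewrite natrX -exprMn; apply: lerXn2r; last exact: divn_lower_bound.
  by rewrite nnegrE mulr_ge0 ?invr_ge0 ?ler0n.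
by rewrite nnegrE ler0n.
Qed.
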